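(* Let Assumptions (A1), (A3) and (A4) below hold and let $C>C(M'):=M'(\ell_{\max}-\ell^\star)+2\bar\lambda+\ell^\star p^\star$. Then there exist $\delta\in\mathcal L$ and $N_0\in\mathbb{N}$ such that for each prediction horizon $N\ge N_0$ the MPC feedback $\mu_N^\beta$ satisfies, for all $x\in\mathbb{X}_{\mathrm{pi}}(C,N_0)$, $$J^{\mathrm{av}}_\infty(x,\mu_N^\beta)\le\ell^\star+\delta(N).$$
   Context: System $x(k+1)=f(x(k),u(k))$ with $f:\mathbb{X}\times\mathbb{U}\to\mathbb{R}^n$, constraint sets $\mathbb{X}\subset\mathbb{R}^n$, $\mathbb{U}\subset\mathbb{R}^m$, stage cost $\ell:\mathbb{X}\times\mathbb{U}\to\mathbb{R}$. For $u\in\mathbb{U}^T$, $x_u(0,x)=x$, $x_u(k+1,x)=f(x_u(k,x),u(k))$; for a feedback $\mu$, $x_\mu(k,x)$ is the closed-loop trajectory with $u(k)=\mu(x_\mu(k,x))$; $\mathbb{U}^T(x)$ is the set of $u\in\mathbb{U}^T$ with $x_u(k,x)\in\mathbb{X}$ for $k=0,\dots,T$. $J_T(x,\mu)=\sum_{k=0}^{T-1}\ell(x_\mu(k,x),\mu(x_\mu(k,x)))$ and $J^{\mathrm{av}}_\infty(x,\mu)=\limsup_{T\to\infty}\frac1TJ_T(x,\mu)$. $[k]_p$ is $k$ mod $p$. A feasible $p$-periodic orbit is $\Pi\in(\mathbb{X}\times\mathbb{U})^p$ with $\Pi_\mathbb{X}([k+1]_p)=f(\Pi(k))$; $\|(x,u)\|_\Pi:=\min_k\|(x,u)-\Pi(k)\|$,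 $\|x\|_{\Pi_\mathbb{X}}:=\min_k\|x-\Pi_\mathbb{X}(k)\|$; $\ell^\star:=\inf$ over all feasible periodic orbits of $\frac1p\sum_{k=0}^{p-1}\ell(\Pi(k))$; $\Pi^\star$ is a fixed feasible $p^\star$-periodic orbit attaining $\ell^\star$. $\ell_{\max}:=\sup_{\mathbb{X}\times\mathbb{U}}\ell$. $\mathcal L$: continuous decreasing functions $[0,\infty)\to[0,\infty)$ tending to $0$. (A1) $f,\ell$ continuous, $\mathbb{X},\mathbb{U}$ compact. (A3) There are $\lambda:\mathbb{X}\to\mathbb{R}$, $\bar\lambda$ with $|\lambda|\le\bar\lambda$ on $\mathbb{X}$, and $\underline\alpha_{\tilde\ell}\in\mathcal K_\infty$ with $\ell(x,u)-\ell^\star+\lambda(x)-\lambda(f(x,u))\ge\underline\alpha_{\tilde\ell}(\|(x,u)\|_{\Pi^\star})$ for all $x\in\mathbb{X}$, $u\in\mathbb{U}^1(x)$. (A4) There are $\kappa>0$, $M'\in\mathbb{N}$, $\rho\in\mathcal K_\infty$ such that for all $z\in\{\Pi^\star_\mathbb{X}(k)\}$ and $x,y\in\mathbb{X}$ with $\|x-z\|,\|y-z\|\le\kappa$ there is $u\in\mathbb{U}^{M'}(x)$ with $x_u(M',x)=y$ and $\|(x_u(k,x),u(k))\|_{\Pi^\star}\le\rho(\max\{\|x\|_{\Pi^\star_\mathbb{X}},\|y\|_{\Pi^\star_\mathbb{X}}\})$ for $k=0,\dots,M'-1$. Discounted MPC: $\beta_N(k)=\frac{N-k}{N}$, $J_N^\beta(x,u)=\sum_{k=0}^{N-1}\beta_N(k)\ell(x_u(k,x),u(k))$,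 $V_N^\beta(x)=\inf_{u\in\mathbb{U}^N(x)}J_N^\beta(x,u)$, $u^\beta_{N,x}$ a minimizer, $\mu_N^\beta(x)=u^\beta_{N,x}(0)$. For $C\in\mathbb{R}$, $N_0\in\mathbb{N}$, $\mathbb{X}_{\mathrm{pi}}(C,N_0)$ is the set of $x\in\mathbb{X}$ with $V_N^\beta(x)-\frac{N+1}{2}\ell^\star+\lambda(x)+\bar\lambda\le C$ for all $N\ge N_0$. *)

(* Defs.v *)
From HB Require Import structures.
From mathcomp Require Import all_boot all_order all_algebra.
From mathcomp Require Import all_classical all_reals all_analysis.
Set Implicit Arguments. Unset Strict Implicit. Unset Printing Implicit Defensive.
Import Order.TTheory GRing.Theory Num.Theory.
Import numFieldNormedType.Exports.
Local Open Scope classical_set_scope.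
Local Open Scope ring_scope.

Section Defs.
Variables (R : realType) (n m : nat).
Notation st := 'rV[R]_n.
Notation inp := 'rV[R]_m.
Variable f : st -> inp -> st.
Variable l : st -> inp -> R.

Definition pnorm (z : st * inp) : R := Num.max `|z.1| `|z.2|.

(* open-loop trajectory x_u(k,x); only u 0 .. u (T-1) matter for horizon T *)
Fixpoint traj (u : nat -> inp) (x : st) (k : nat) : st :=
  if k is k'.+1 then f (traj u x k') (u k') else x.

Definition admissible (X : set st) (U : set inp) (T : nat) (x : st)
  (u : nat -> inp) : Prop :=
  (forall k, (k < T)%N -> U (u k)) /\ (forall k, (k <= T)%N -> X (traj u x k)).

Fixpoint cltraj (mu : st -> inp) (x : st) (k : nat) : st :=
  if k is k'.+1 then f (cltraj mu x k') (mu (cltraj mu x k')) else x.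

Definition JT (mu : st -> inp) (x : st) (T : nat) : R :=
  \sum_(k < T) l (cltraj mu x k) (mu (cltraj mu x k)).

Definition Jav (mu : st -> inp) (x : st) : \bar R :=
  limn_esup (fun T : nat => ((JT mu x T) / T%:R)%:E).

Definition periodic_orbit (X : set st) (U : set inp) (p : nat)
  (Pi : nat -> st * inp) : Prop :=
  (0 < p)%N /\
  (forall k, (k < p)%N -> X (Pi k).1 /\ U (Pi k).2) /\
  (forall k, (k < p)%N -> (Pi ((k.+1) %% p)%N).1 = f (Pi k).1 (Pi k).2).

Definition avg_cost (p : nat) (Pi : nat -> st * inp) : R :=
  (\sum_(k < p) l (Pi k).1 (Pi k).2) / p%:R.

Definition dist_orbit (p : nat) (Pi : nat -> st * inp) (z : st * inp) : R :=
  \big[Num.min/pnorm (z.1 - (Pi 0%N).1, z.2 - (Pi 0%N).2)]_(k < p)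
     pnorm (z.1 - (Pi k).1, z.2 - (Pi k).2).

Definition dist_orbitX (p : nat) (Pi : nat -> st * inp) (x : st) : R :=
  \big[Num.min/`|x - (Pi 0%N).1|]_(k < p) `|x - (Pi k).1|.

Definition lstar (X : set st) (U : set inp) : R :=
  inf [set r | exists p Pi, periodic_orbit X U p Pi /\ r = avg_cost p Pi].

Definition lmax (X : set st) (U : set inp) : R :=
  sup [set l x u | x in X & u in U].

Definition beta (N k : nat) : R := (N%:R - k%:R) / N%:R.

Definition JNbeta (N : nat) (x : st) (u : nat -> inp) : R :=
  \sum_(k < N) beta N k * l (traj u x k) (u k).

(* V_N^beta(x) = inf over U^N(x); +oo if U^N(x) is empty *)
Definition VNbeta (X : set st) (U : set inp) (N : nat) (x : st) : \bar R :=
  ereal_inf [set (JNbeta N x u)%:E | u in admissible X U N x].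

Definition is_MPC_feedback (X : set st) (U : set inp) (N : nat)
  (mu : st -> inp) : Prop :=
  forall x, X x -> (exists u, admissible X U N x u) ->
    exists u, [/\ admissible X U N x u,
                  (forall v, admissible X U N x v -> JNbeta N x u <= JNbeta N x v)
                & mu x = u 0%N].

Definition Xpi (X : set st) (U : set inp) (lam : st -> R) (lambar : R)
  (C : R) (N0 : nat) : set st :=
  [set x | X x /\ forall N, (N0 <= N)%N ->
     (VNbeta X U N x - ((N%:R + 1) / 2 * lstar X U)%:E
        + (lam x + lambar)%:E <= C%:E)%E].

End Defs.

Definition Kinf {R : realType} (a : R -> R) : Prop :=
  [/\ a 0 = 0,
      {within [set x : R | 0 <= x], continuous a},
      (forall x y, 0 <= x -> x < y -> a x < a y)
    & (forall M, exists x, 0 <= x /\ M < a x)].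

Definition Lclass {R : realType} (d : R -> R) : Prop :=
  [/\ {within [set x : R | 0 <= x], continuous d},
      (forall x, 0 <= x -> 0 <= d x),
      (forall x y, 0 <= x -> x < y -> d y < d x)
    & d x @[x --> +oo] --> 0].

(* Main.v *)
(* By summation by parts the linearly discounted cost is the average of the
   undiscounted costs over the horizons 1, ..., N. If the value at x is bounded,
   dissipativity therefore forces the optimal trajectory close to the optimal
   orbit at some time P <= N/2. Local controllability there gives a loop of fixed
   length L whose average cost is nearly l*; inserting it at time P into the
   shifted optimal input (and dropping the last L - 1 steps) yields
   V(x1) <= V(x) - l(x0,u0) + l* + o(1). Hence the bound on the value propagates
   along the closed loop, and summing this inequality bounds the average cost. *)
Require Import Defs.
From HB Require Import structures.
From mathcomp Require Import all_boot all_order all_algebra.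
From mathcomp Require Import all_classical all_reals all_analysis.
From mathcomp Require Import ring lra zify.
Import Order.TTheory GRing.Theory Num.Theory.
Import numFieldNormedType.Exports.
Local Open Scope classical_set_scope.
Local Open Scope ring_scope.
Set Implicit Arguments.
Unset Strict Implicit.
Unset Printing Implicit Defensive.

(** * Finite sums and concatenation of inputs *)

(** The term [a k] occurs once for every horizon [T.+1 > k], hence [N - k] times: these are the
    weights of the linear discount. *)
Lemma sum_partial_sums {R : realType} (a : nat -> R) (N : nat) :
  \sum_(T < N) \sum_(k < T.+1) a k = \sum_(k < N) (N%:R - k%:R) * a k.
Proof.
elim: N => [|N IHN]; first by rewrite !big_ord0.
rewrite big_ord_recr /= IHN [RHS]big_ord_recr /= [in LHS]big_ord_recr /= addrA.
rewrite -big_split /=; congr (_ + _); last by rewrite -natr1; ring.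
by apply: eq_bigr => i _; rewrite -natr1; ring.
Qed.

Lemma sum_succ_nat {R : realType} (N : nat) :
  \sum_(T < N) (T.+1%:R : R) = N%:R * (N%:R + 1) / 2.
Proof.
elim: N => [|N IHN]; first by rewrite big_ord0 !mul0r.
by rewrite big_ord_recr /= IHN -natr1; field.
Qed.

Lemma big_ord_addn {R : realType} (a : nat -> R) (p q : nat) :
  \sum_(i < p + q) a i = \sum_(i < p) a i + \sum_(i < q) a (p + i)%N.
Proof. by rewrite big_split_ord. Qed.

Lemma sum_ord_const {R : realType} (c : R) (N : nat) : \sum_(i < N) c = N%:R * c.
Proof. by rewrite sumr_const card_ord mulr_natl. Qed.

Definition shift_input {A : Type} (p : nat) (u : nat -> A) : nat -> A :=
  fun k => u (p + k)%N.

Definition concat_input {A : Type} (p : nat) (u v : nat -> A) : nat -> A :=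
  fun k => if (k < p)%N then u k else v (k - p)%N.

Lemma concat_input_l {A : Type} (p : nat) (u v : nat -> A) k :
  (k < p)%N -> concat_input p u v k = u k.
Proof. by rewrite /concat_input => ->. Qed.

Lemma concat_input_r {A : Type} (p : nat) (u v : nat -> A) k :
  concat_input p u v (p + k)%N = v k.
Proof. by rewrite /concat_input ltnNge leq_addr /= addKn. Qed.

(** * Concatenated inputs and discounted costs *)

Section Trajectories.
Context {R : realType} {n m : nat}.
Variables (f : 'rV[R]_n -> 'rV[R]_m -> 'rV[R]_n) (l : 'rV[R]_n -> 'rV[R]_m -> R).
Variables (X : set 'rV[R]_n) (U : set 'rV[R]_m).

Lemma traj_shift u x p k :
  traj f (shift_input p u) (traj f u x p) k = traj f u x (p + k).
Proof. by elim: k => [|k IHk]; rewrite ?addn0 // addnS /= IHk. Qed.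

Lemma traj_concat_l p u v x k :
  (k <= p)%N -> traj f (concat_input p u v) x k = traj f u x k.
Proof.
by elim: k => // k IHk kp /=; rewrite IHk ?(ltnW kp)// concat_input_l.
Qed.

Lemma traj_concat_r p u v x k :
  traj f (concat_input p u v) x (p + k) = traj f v (traj f u x p) k.
Proof.
elim: k => [|k IHk]; first by rewrite addn0 traj_concat_l.
by rewrite addnS /= IHk concat_input_r.
Qed.

Lemma admissible_le {T} T' {x u} :
  (T' <= T)%N -> admissible f X U T x u -> admissible f X U T' x u.
Proof.
move=> T'T [uU xX]; split => k kT'; [apply: uU | apply: xX].
- exact: leq_trans T'T.
- exact: leq_trans T'T.
Qed.

Lemma admissible_shift p T x u : admissible f X U (p + T) x u ->
  admissible f X U T (traj f u x p) (shift_input p u).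
Proof.
move=> [uU xX]; split => k kT; first by apply: uU; rewrite ltn_add2l.
by rewrite traj_shift; apply: xX; rewrite leq_add2l.
Qed.

Lemma admissible_concat p T x u v : admissible f X U p x u ->
  admissible f X U T (traj f u x p) v ->
  admissible f X U (p + T) x (concat_input p u v).
Proof.
move=> [uU xX] [vU yX]; split => k kT.
- have [kp|pk] := ltnP k p; first by rewrite concat_input_l //; exact: uU.
  by rewrite -(subnKC pk) concat_input_r; apply: vU; rewrite ltn_subLR.
- have [kp|pk] := leqP k p; first by rewrite traj_concat_l //; exact: xX.
  by rewrite -(subnKC (ltnW pk)) traj_concat_r; apply: yX; rewrite leq_subLR.
Qed.

Variable ls : R.

(** The baseline [ls] is arbitrary here; once it is the optimal average, dissipativity bounds this
    sum below uniformly in [T]. *)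
Definition excess_cost (x : 'rV[R]_n) (u : nat -> 'rV[R]_m) (T : nat) : R :=
  \sum_(k < T) (l (traj f u x k) (u k) - ls).

Lemma excess_cost0 x u : excess_cost x u 0 = 0.
Proof. by rewrite /excess_cost big_ord0. Qed.

Lemma excess_costS x u T : excess_cost x u T.+1 =
  excess_cost x u T + (l (traj f u x T) (u T) - ls).
Proof. by rewrite /excess_cost big_ord_recr. Qed.

Lemma excess_cost_shift p x u T :
  excess_cost (traj f u x p) (shift_input p u) T =
  excess_cost x u (p + T) - excess_cost x u p.
Proof.
rewrite /excess_cost (big_ord_addn (fun k => l (traj f u x k) (u k) - ls)).
rewrite addrC addKr; apply: eq_bigr => i _.
by rewrite traj_shift.
Qed.

Lemma excess_cost_concat_l p u v x T : (T <= p)%N ->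
  excess_cost x (concat_input p u v) T = excess_cost x u T.
Proof.
move=> Tp; apply: eq_bigr => i _.
have ip : (i < p)%N by exact: leq_trans Tp.
by rewrite traj_concat_l ?concat_input_l // ltnW.
Qed.

Lemma excess_cost_concat_r p u v x T :
  excess_cost x (concat_input p u v) (p + T) =
  excess_cost x u p + excess_cost (traj f u x p) v T.
Proof.
rewrite {1}/excess_cost (big_ord_addn (fun k =>
  l (traj f (concat_input p u v) x k) (concat_input p u v k) - ls)).
congr (_ + _); first exact: excess_cost_concat_l.
by apply: eq_bigr => i _; rewrite traj_concat_r concat_input_r.
Qed.

(* Summation by parts: the linear discount averages the undiscounted costs over
   the horizons 1, ..., N. *)
Lemma JNbeta_excess_cost N x u : (0 < N)%N ->
  JNbeta f l N x u =
  (\sum_(T < N) excess_cost x u T.+1) / N%:R + (N%:R + 1) / 2 * ls.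
Proof.
move=> N0; have Nn0 : N%:R != 0 :> R by rewrite pnatr_eq0 -lt0n.
rewrite (sum_partial_sums (fun k => l (traj f u x k) (u k) - ls)).
under eq_bigr do rewrite mulrBr.
rewrite sumrB -mulr_suml -[X in _ - X * _]/(\sum_(k < N) _).
have -> : \sum_(k < N) (N%:R - k%:R : R) = N%:R * (N%:R + 1) / 2.
  rewrite -sum_succ_nat -[RHS](_ : \sum_(T < N) \sum_(k < T.+1) 1 = _).
    by rewrite (sum_partial_sums (fun=> 1)); apply: eq_bigr => i _; rewrite mulr1.
  by apply: eq_bigr => i _; rewrite sumr_const card_ord.
rewrite mulrBl mulr_suml /JNbeta.
under eq_bigr do rewrite /beta mulrAC.
by field.
Qed.

End Trajectories.

(** * Minima, comparison functions and uniform moduli *)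

(** The default [F 0] of the iterated minimum is itself one of the values, as [p] is positive. *)
Lemma bigmin_ord_attained {R : realType} (F : nat -> R) (p : nat) : (0 < p)%N ->
  exists2 k, (k < p)%N & \big[Num.min/F 0%N]_(k < p) F k = F k.
Proof.
move=> p0; apply: (big_ind (fun x => exists2 k, (k < p)%N & x = F k)).
- by exists 0%N.
- move=> _ _ [i ip ->] [j jp ->].
  by rewrite /Num.min; case: ifP => _; [exists i | exists j].
- by move=> i _; exists i.
Qed.

Lemma sum_modn_succ {R : realType} (F : nat -> R) (p : nat) :
  \sum_(k < p) F (k.+1 %% p)%N = \sum_(k < p) F k.
Proof.
case: p => [|p]; first by rewrite !big_ord0.
rewrite big_ord_recr big_ord_recl /= modnn addrC; congr (_ + _).
by apply: eq_bigr => i _; rewrite modn_small // ltnS.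
Qed.

Lemma Kinf_le_inv {R : realType} (a : R -> R) (d x : R) :
  Kinf a -> 0 <= d -> a x <= a d -> x <= d.
Proof.
move=> [_ _ ainc _] d0; apply: contraLR; rewrite -!ltNge; exact: ainc.
Qed.

Lemma Kinf_ge0 {R : realType} (a : R -> R) (x : R) : Kinf a -> 0 <= x -> 0 <= a x.
Proof.
move=> [a0 _ ainc _]; rewrite le_eqVlt => /predU1P[<-|x0]; first by rewrite a0.
by rewrite -a0 ltW // ainc.
Qed.

Lemma Kinf_small {R : realType} (a : R -> R) (e : R) : Kinf a -> 0 < e ->
  exists2 d, 0 < d & forall x, 0 <= x -> x <= d -> a x <= e.
Proof.
move=> [a0 acont _ _] e0; move/subspace_continuousP: acont => /(_ 0 (lexx _)).
move=> /cvgrPdist_le /(_ e e0) /nbhs_ballP[d /= d0 ad].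
exists (d / 2); first by rewrite divr_gt0.
move=> x x0 xd.
have /ad/(_ x0) : ball (0 : R) d x by rewrite /ball /= sub0r normrN ger0_norm //; lra.
by rewrite /from_subspace a0 sub0r normrN; apply: le_trans; exact: ler_norm.
Qed.

(** A minimum of finitely many positive moduli serves all indices, since [Q k] is closed under
    shrinking the modulus. *)
Lemma uniform_modulus {R : realType} (Q : nat -> R -> Prop) (p : nat) :
  (forall k d d', Q k d -> d' <= d -> Q k d') ->
  (forall k, (k < p)%N -> exists2 d, 0 < d & Q k d) ->
  exists2 d, 0 < d & forall k, (k < p)%N -> Q k d.
Proof.
move=> Qle; elim: p => [_|p IHp Qex]; first by exists 1.
have [k kp|d d0 dQ] := IHp; first by apply: Qex; exact: ltnW.
have [e e0 eQ] := Qex p (ltnSn p).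
exists (Num.min d e); first by rewrite lt_min d0.
move=> k; rewrite ltnS leq_eqVlt => /predU1P[->|kp].
  by apply: Qle eQ _; rewrite ge_min lexx orbT.
by apply: Qle (dQ _ kp) _; rewrite ge_min lexx.
Qed.

Lemma within_continuous_modulus {R : realType} {n m : nat}
    {V : normedModType R} (g : 'rV[R]_n * 'rV[R]_m -> V)
    (X : set 'rV[R]_n) (U : set 'rV[R]_m) (z : 'rV[R]_n * 'rV[R]_m) (e : R) :
  {within X `*` U, continuous g} -> X z.1 -> U z.2 -> 0 < e ->
  exists2 d, 0 < d & forall x u, X x -> U u ->
    pnorm (x - z.1, u - z.2) <= d -> `|g (x, u) - g z| <= e.
Proof.
move=> gcont Xz Uz e0; move/subspace_continuousP: gcont => /(_ z (conj Xz Uz)).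
move=> /cvgrPdist_le /(_ e e0) /nbhs_ballP[d /= d0 dg].
exists (d / 2); first by rewrite divr_gt0.
move=> x u Xx Uu; rewrite /pnorm /= ge_max => /andP[xd ud].
rewrite distrC; apply: dg => //; split; rewrite -ball_normE /ball_ /= distrC.
- by apply: le_lt_trans xd _; lra.
- by apply: le_lt_trans ud _; lra.
Qed.

(** * Trajectories near the optimal orbit *)

Section DissipativeOrbit.
Context {R : realType} {n m : nat}.
Variables (f : 'rV[R]_n -> 'rV[R]_m -> 'rV[R]_n) (l : 'rV[R]_n -> 'rV[R]_m -> R).
Variables (X : set 'rV[R]_n) (U : set 'rV[R]_m).
Variables (p : nat) (Pi : nat -> 'rV[R]_n * 'rV[R]_m).
Variables (lam : 'rV[R]_n -> R) (lambar : R) (alpha : R -> R) (ls : R).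

Hypothesis fcont : {within X `*` U, continuous (fun z => f z.1 z.2)}.
Hypothesis lcont : {within X `*` U, continuous (fun z => l z.1 z.2)}.
Hypothesis orbitPi : periodic_orbit f X U p Pi.
Hypothesis avgPi : avg_cost l p Pi = ls.
Hypothesis lam_bounded : forall x, X x -> `|lam x| <= lambar.
Hypothesis alphaK : Kinf alpha.
Hypothesis dissip : forall x u, X x -> U u -> X (f x u) ->
  alpha (dist_orbit p Pi (x, u)) <= l x u - ls + lam x - lam (f x u).

Let p_gt0 : (0 < p)%N. Proof. by case: orbitPi. Qed.

Let PiX k : (k < p)%N -> X (Pi k).1.
Proof. by move=> kp; case: orbitPi => _ [/(_ _ kp)[]]. Qed.

Let PiU k : (k < p)%N -> U (Pi k).2.
Proof. by move=> kp; case: orbitPi => _ [/(_ _ kp)[]]. Qed.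

Let PiS k : (k < p)%N -> f (Pi k).1 (Pi k).2 = (Pi (k.+1 %% p)).1.
Proof. by move=> kp; case: orbitPi => _ [_ ->]. Qed.

Let modp k : (k %% p < p)%N. Proof. by rewrite ltn_mod. Qed.

Let lambar_bound x : X x -> - lambar <= lam x <= lambar.
Proof. by move=> /lam_bounded; rewrite ler_norml. Qed.

Lemma dist_orbit_attained z : exists2 k, (k < p)%N &
  dist_orbit p Pi z = pnorm (z.1 - (Pi k).1, z.2 - (Pi k).2).
Proof.
exact: (@bigmin_ord_attained _
  (fun k => pnorm (z.1 - (Pi k).1, z.2 - (Pi k).2)) p p_gt0).
Qed.

Lemma dist_orbitX_attained x : exists2 k, (k < p)%N &
  dist_orbitX p Pi x = `|x - (Pi k).1|.
Proof. exact: (@bigmin_ord_attained _ (fun k => `|x - (Pi k).1|) p p_gt0). Qed.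

Lemma dist_orbit_ge0 z : 0 <= dist_orbit p Pi z.
Proof.
by have [k _ ->] := dist_orbit_attained z; rewrite le_max normr_ge0.
Qed.

Lemma dist_orbitX_ge0 x : 0 <= dist_orbitX p Pi x.
Proof. by have [k _ ->] := dist_orbitX_attained x. Qed.

Lemma dist_orbitX_leP x k : (k < p)%N -> dist_orbitX p Pi x <= `|x - (Pi k).1|.
Proof. by move=> kp; exact: (bigmin_le _ (Ordinal kp)). Qed.

Lemma dist_orbitX_le x u : dist_orbitX p Pi x <= dist_orbit p Pi (x, u).
Proof.
have [k kp ->] := dist_orbit_attained (x, u).
by rewrite (le_trans (dist_orbitX_leP x kp)) // le_max lexx.
Qed.

Lemma dist_orbitX_orbit k : (k < p)%N -> dist_orbitX p Pi (Pi k).1 = 0.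
Proof.
move=> kp; apply/eqP; rewrite eq_le dist_orbitX_ge0 andbT.
by rewrite (le_trans (dist_orbitX_leP _ kp)) // subrr normr0.
Qed.

(* The rotated costs along the orbit are nonnegative and sum to zero. *)
Lemma orbit_cost k : (k < p)%N ->
  l (Pi k).1 (Pi k).2 - ls = lam (Pi (k.+1 %% p)).1 - lam (Pi k).1.
Proof.
move=> kp.
pose g k := l (Pi k).1 (Pi k).2 - ls + lam (Pi k).1 - lam (Pi (k.+1 %% p)).1.
have g0 j : (j < p)%N -> 0 <= g j.
  move=> jp; have := dissip (PiX jp) (PiU jp).
  rewrite PiS // => /(_ (PiX (modp _))); apply: le_trans.
  exact/Kinf_ge0/dist_orbit_ge0.
(* The storage terms cancel because the successor modulo [p] permutes the indices; the stage costs
   sum to [p * ls] by [avgPi]. *)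
have sg : \sum_(j < p) g j = 0.
  rewrite sumrB big_split /= (sum_modn_succ (fun j => lam (Pi j).1)) addrK.
  rewrite sumrB sumr_const card_ord -avgPi /avg_cost -[_ *+ p]mulr_natr.
  by rewrite divfK ?subrr // pnatr_eq0 -lt0n.
have : g k = 0.
  by have := psumr_eq0P (fun i _ => g0 _ (ltn_ord i)) sg (i := Ordinal kp) isT.
by rewrite /g => /eqP; rewrite subr_eq0 => /eqP <-; rewrite addrK.
Qed.

(** Only the indices below [p] of [Pi] are meaningful; the reduction modulo [p] follows the orbit
    forever from phase [k]. *)
Definition orbit_input (k i : nat) : 'rV[R]_m := (Pi ((k + i) %% p)).2.

Lemma traj_orbit k i : (k < p)%N ->
  traj f (orbit_input k) (Pi k).1 i = (Pi ((k + i) %% p)).1.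
Proof.
move=> kp; elim: i => [|i IHi] /=; first by rewrite addn0 modn_small.
rewrite IHi /orbit_input PiS //; congr (Pi _).1.
by rewrite addnS -addn1 modnDml addn1.
Qed.

Lemma admissible_orbit k T : (k < p)%N ->
  admissible f X U T (Pi k).1 (orbit_input k).
Proof.
by move=> kp; split => i _; [exact: PiU | rewrite traj_orbit //; exact: PiX].
Qed.

Lemma excess_cost_orbit k T : (k < p)%N ->
  excess_cost f l ls (Pi k).1 (orbit_input k) T =
  lam (Pi ((k + T) %% p)).1 - lam (Pi k).1.
Proof.
move=> kp; elim: T => [|T IHT].
  by rewrite excess_cost0 addn0 modn_small // subrr.
rewrite excess_costS IHT traj_orbit // orbit_cost //.
by rewrite -[((k + T) %% p).+1]addn1 modnDml addn1 addnS; ring.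
Qed.

Lemma excess_cost_orbit_le k T : (k < p)%N ->
  excess_cost f l ls (Pi k).1 (orbit_input k) T <= 2 * lambar.
Proof.
move=> kp; rewrite excess_cost_orbit //.
have := lambar_bound (PiX kp); have := lambar_bound (PiX (modp (k + T))).
by move=> /andP[? ?] /andP[? ?]; lra.
Qed.

(** One step of dissipativity: excess cost minus storage grows by exactly the rotated stage cost. *)
Lemma rotated_excess_cost_ge T x u k : admissible f X U T x u -> (k < T)%N ->
  alpha (dist_orbit p Pi (traj f u x k, u k)) <=
  excess_cost f l ls x u k.+1 - lam (traj f u x k.+1)
  - (excess_cost f l ls x u k - lam (traj f u x k)).
Proof.
move=> [uU xX] kT; have := dissip (xX _ (ltnW kT)) (uU _ kT) (xX _ kT).
by rewrite excess_costS /= => /le_trans; apply; lra.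
Qed.

Lemma rotated_excess_cost_nondecr T x u i j : admissible f X U T x u ->
  (i <= j <= T)%N ->
  excess_cost f l ls x u i - lam (traj f u x i) <=
  excess_cost f l ls x u j - lam (traj f u x j).
Proof.
move=> xu /andP[ij jT]; rewrite -(subnKC ij) in jT *.
elim: (j - i)%N jT => [|k IHk]; first by rewrite addn0.
rewrite addnS => ikT; rewrite (le_trans (IHk (ltnW ikT))) // -subr_ge0.
apply: le_trans (rotated_excess_cost_ge xu ikT).
exact/Kinf_ge0/dist_orbit_ge0.
Qed.

Lemma excess_cost_ge T x u k : admissible f X U T x u -> (k <= T)%N ->
  - (2 * lambar) <= excess_cost f l ls x u k.
Proof.
move=> xu kT.
have := rotated_excess_cost_nondecr xu (i := 0) (j := k) kT.
rewrite excess_cost0 /=; case: xu => _ xX.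
have /= := lambar_bound (xX _ (leq0n T)); have := lambar_bound (xX _ kT).
by move=> /andP[? ?] /andP[? ?]; lra.
Qed.

(** Finitely many distinct points have a positive minimal distance. States may recur within a
    period, so states rather than indices are identified. *)
Lemma orbit_separated : exists2 s, 0 < s & forall j k, (j < p)%N -> (k < p)%N ->
  `|(Pi j).1 - (Pi k).1| <= s -> (Pi j).1 = (Pi k).1.
Proof.
pose Q k (s : R) := forall j, (j < p)%N -> `|(Pi j).1 - (Pi k).1| <= s ->
  (Pi j).1 = (Pi k).1.
have [||s s0 sQ] := @uniform_modulus R Q p; last by exists s => // j k jp /sQ; apply.
  by move=> k d d' dQ d'd j jp jd'; apply: dQ => //; exact: le_trans d'd.
move=> k kp; apply: (@uniform_modulus R (fun j s => `|(Pi j).1 - (Pi k).1| <= s ->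
  (Pi j).1 = (Pi k).1)).
  by move=> j d d' dQ d'd jd'; apply: dQ => //; exact: le_trans d'd.
move=> j jp; have [->|jk] := eqVneq (Pi j).1 (Pi k).1; first by exists 1.
have jk0 : 0 < `|(Pi j).1 - (Pi k).1| by rewrite normr_gt0 subr_eq0.
exists (`|(Pi j).1 - (Pi k).1| / 2); first by rewrite divr_gt0.
by move=> ?; exfalso; lra.
Qed.

Lemma orbit_modulus (e : R) : 0 < e -> exists2 d, 0 < d &
  forall k x u, (k < p)%N -> X x -> U u ->
    pnorm (x - (Pi k).1, u - (Pi k).2) <= d ->
    `|l x u - l (Pi k).1 (Pi k).2| <= e /\
    `|f x u - (Pi (k.+1 %% p)).1| <= e.
Proof.
move=> e0.
have [||d d0 dQ] := @uniform_modulus R (fun k d => forall x u, X x -> U u ->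
    pnorm (x - (Pi k).1, u - (Pi k).2) <= d ->
    `|l x u - l (Pi k).1 (Pi k).2| <= e /\
    `|f x u - (Pi (k.+1 %% p)).1| <= e) p; last by exists d => // k x u /dQ; apply.
  by move=> k d d' dQ d'd x u Xx Uu xud'; apply: dQ => //; exact: le_trans d'd.
move=> k kp.
have [d d0 dl] := within_continuous_modulus lcont (PiX kp) (PiU kp) e0.
have [d' d'0 df] := within_continuous_modulus fcont (PiX kp) (PiU kp) e0.
exists (Num.min d d'); first by rewrite lt_min d0.
move=> x u Xx Uu; rewrite le_min => /andP[xud xud']; split; first exact: dl.
by rewrite -PiS //; exact: df.
Qed.

Let S x u T := excess_cost f l ls x u T.

Let lambar_ge0 : 0 <= lambar.
Proof. exact: le_trans (lam_bounded (PiX p_gt0)). Qed.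

(* Orbit points closer than their separation coincide, so a path that stays near
   the orbit shadows a walk on it, whose cost telescopes by [orbit_cost]. *)
Lemma near_orbit_cost (e : R) : 0 < e -> exists2 d, 0 < d &
  forall L x w, admissible f X U L x w -> dist_orbitX p Pi x <= d ->
    (forall j, (j < L)%N -> dist_orbit p Pi (traj f w x j, w j) <= d) ->
    (forall T, (T <= L)%N -> S x w T <= T%:R * e + 2 * lambar) /\
    (traj f w x L = x -> S x w L <= L%:R * e).
Proof.
move=> e0; have [s s0 sep] := orbit_separated.
(* The part [e] bounds the cost error per step; the part [s / 2] keeps the successor close enough to
   identify its orbit state. *)
have [d d0 dmod] : exists2 d, 0 < d &
    forall k x u, (k < p)%N -> X x -> U u ->
    pnorm (x - (Pi k).1, u - (Pi k).2) <= d ->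
    `|l x u - l (Pi k).1 (Pi k).2| <= Num.min e (s / 2) /\
    `|f x u - (Pi (k.+1 %% p)).1| <= Num.min e (s / 2).
  by apply: orbit_modulus; rewrite lt_min e0 divr_gt0.
exists (Num.min d (s / 2)); first by rewrite lt_min d0 divr_gt0.
move=> L x w [wU xX]; rewrite le_min => /andP[_ xs] near.
have [q qp dq] := dist_orbitX_attained x; rewrite dq in xs.
have close y i j : (i < p)%N -> (j < p)%N -> `|y - (Pi i).1| <= s / 2 ->
    `|y - (Pi j).1| <= s / 2 -> (Pi i).1 = (Pi j).1.
  move=> ip jp yi yj; apply: sep => //.
  have := ler_distD y (Pi i).1 (Pi j).1; rewrite (distrC (Pi i).1 y) => /le_trans.
  by apply; lra.
(* The pair nearest to the current state and input may have an index other than [q'], but [close]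
   shows that the two orbit states agree. *)
have walk T : (T <= L)%N -> exists q', [/\ (q' < p)%N,
    `|traj f w x T - (Pi q').1| <= s / 2 &
    S x w T <= T%:R * e + lam (Pi q').1 - lam (Pi q).1].
  elim: T => [_|T IHT TL].
    by exists q; split; rewrite // /S excess_cost0 mul0r add0r subrr.
  have [q' [q'p xq' Sq']] := IHT (ltnW TL).
  have := near _ TL; rewrite le_min.
  have [k kp ->] := dist_orbit_attained (traj f w x T, w T) => /andP[wd ws].
  have [dl df] := dmod _ _ _ kp (xX _ (ltnW TL)) (wU _ TL) wd.
  have q'k : (Pi q').1 = (Pi k).1.
    by apply: close xq' _ => //; apply: le_trans ws; rewrite le_max lexx.
  exists (k.+1 %% p)%N; split => //.
    by move: df; rewrite le_min => /andP[].
  move: dl; rewrite le_min ler_norml => /andP[/andP[_ dl] _].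
  rewrite /S excess_costS -/(S _ _ _) -natr1 mulrDl mul1r.
  by have := orbit_cost kp; rewrite q'k in Sq'; lra.
split=> [T TL|xL].
  have [q' [q'p _ /le_trans]] := walk _ TL; apply.
  have := lambar_bound (PiX qp); have := lambar_bound (PiX q'p).
  by move=> /andP[? ?] /andP[? ?]; lra.
have [q' [q'p]] := walk _ (leqnn L); rewrite xL => xq'.
(* On a closed path the first and last orbit states are both near [x], so they coincide and the
   storage terms cancel. *)
by rewrite (close _ _ _ q'p qp xq' xs) addrK.
Qed.

(** * Loops, the turnpike property and descent under local controllability *)

Variables (kappa : R) (M' : nat) (rho : R -> R).
Hypothesis kappa_gt0 : 0 < kappa.
Hypothesis rhoK : Kinf rho.
Hypothesis local_ctrl : forall k x y, (k < p)%N -> X x -> X y ->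
  `|x - (Pi k).1| <= kappa -> `|y - (Pi k).1| <= kappa ->
  exists u, [/\ admissible f X U M' x u, traj f u x M' = y &
    forall j, (j < M')%N -> dist_orbit p Pi (traj f u x j, u j)
      <= rho (Num.max (dist_orbitX p Pi x) (dist_orbitX p Pi y))].

(** Steering [x] to itself closes a path near the orbit, whose excess cost is small by
    [near_orbit_cost]. The length [L] does not depend on [e]. *)
Lemma orbit_loop : exists2 L, (0 < L)%N &
  forall e, 0 < e -> exists2 d, 0 < d &
  forall x, X x -> dist_orbitX p Pi x <= d -> exists w,
    [/\ admissible f X U L x w, traj f w x L = x, S x w L <= e &
        forall T, (T <= L)%N -> S x w T <= L%:R + 2 * lambar].
Proof.
have [M0|M0] := posnP M'.
  (* Control in zero steps isolates the orbit points in X. *)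
  exists p => // e e0; exists kappa => // x Xx.
  have [k kp ->] := dist_orbitX_attained x => xk.
  have [|u [_]] := local_ctrl kp Xx (PiX kp) xk.
    by rewrite subrr normr0 ltW.
  rewrite M0 /= => -> _; exists (orbit_input k); split.
  - exact: admissible_orbit.
  - by rewrite traj_orbit // modnDr modn_small.
  - by rewrite /S excess_cost_orbit // modnDr modn_small // subrr ltW.
  - move=> T _; apply: le_trans (excess_cost_orbit_le _ kp) _.
    by rewrite lerDr.
exists M' => // e e0; have M0' : 0 < M'%:R :> R by rewrite ltr0n.
(* The tolerance [e / M'] adds up to [e] over the loop; the cap 1 makes the bound on the
   intermediate costs independent of [e]. *)
have [d d0 dcost] : exists2 d, 0 < d &
  forall L x w, admissible f X U L x w -> dist_orbitX p Pi x <= d ->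
    (forall j, (j < L)%N -> dist_orbit p Pi (traj f w x j, w j) <= d) ->
    (forall T, (T <= L)%N ->
       S x w T <= T%:R * Num.min (e / M'%:R) 1 + 2 * lambar) /\
    (traj f w x L = x -> S x w L <= L%:R * Num.min (e / M'%:R) 1).
  by apply: near_orbit_cost; rewrite lt_min divr_gt0 //=.
have [r r0 rd] := Kinf_small rhoK d0.
exists (Num.min (Num.min d r) kappa); first by rewrite !lt_min d0 r0.
move=> x Xx; rewrite !le_min => /andP[/andP[xd xr] xk].
have [k kp dk] := dist_orbitX_attained x; rewrite dk in xk.
have [w [wadm wx wd]] := local_ctrl kp Xx Xx xk xk.
have [|Sle SM] := dcost _ _ _ wadm xd.
  by move=> j jM; apply: le_trans (wd _ jM) _; rewrite maxxx rd // dist_orbitX_ge0.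
exists w; split => //.
  rewrite (le_trans (SM wx)) // -ler_pdivlMl // mulrC.
  by rewrite ge_min lexx.
move=> T TM; rewrite (le_trans (Sle _ TM)) // lerD2r.
rewrite -[leRHS]mulr1 ler_pM // ?ler_nat // ?ge_min ?lexx ?orbT //.
by rewrite le_min divr_ge0 ?ler01 // ltW.
Qed.

(** Steer onto the orbit in [M'] steps, at cost at most [M' + 2 * lambar], then follow it at
    additional cost at most [2 * lambar], whatever the horizon. *)
Lemma bounded_cost_near_orbit : exists B : R, exists2 d, 0 < d &
  forall x, X x -> dist_orbitX p Pi x <= d -> forall N, exists v,
    admissible f X U N x v /\ forall T, (T <= N)%N -> S x v T <= B.
Proof.
have [d d0 dcost] := near_orbit_cost ltr01.
have [r r0 rd] := Kinf_small rhoK d0.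
exists (M'%:R + 2 * lambar + 2 * lambar).
exists (Num.min (Num.min d r) kappa); first by rewrite !lt_min d0 r0.
move=> x Xx; rewrite !le_min => /andP[/andP[xd xr] xk] N.
have [k kp dk] := dist_orbitX_attained x; rewrite dk in xk.
have [|w [wadm wx wd]] := local_ctrl kp Xx (PiX kp) xk.
  by rewrite subrr normr0 ltW.
have [|Sle _] := dcost _ _ _ wadm xd.
  move=> j jM; apply: le_trans (wd _ jM) _; rewrite (dist_orbitX_orbit kp).
  by rewrite (max_l (dist_orbitX_ge0 x)) rd // dist_orbitX_ge0.
have Sw T : (T <= M')%N -> S x w T <= M'%:R + 2 * lambar.
  by move=> TM; rewrite (le_trans (Sle _ TM)) // mulr1 lerD2r ler_nat.
exists (concat_input M' w (orbit_input k)); split.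
  apply: (admissible_le (leq_addl M' N)); apply: admissible_concat => //.
  by rewrite wx; exact: admissible_orbit.
move=> T _; have [TM|MT] := leqP T M'.
  rewrite /S excess_cost_concat_l // (le_trans (Sw _ TM)) // lerDl.
  by rewrite mulr_ge0.
rewrite -(subnKC (ltnW MT)) /S excess_cost_concat_r wx lerD ?Sw //.
exact: excess_cost_orbit_le.
Qed.

(** The rotated costs [r] are nonnegative and nondecreasing with mean at most [K], so [r] is at most
    [2 * K] at half time. Each step away from the orbit adds at least [alpha d], so not all of them
    can stay away. A positive time is sought because the first step is consumed by the shift in
    [descent]. *)
Lemma turnpike (K d : R) : 0 < d -> exists N1, forall N, (N1 <= N)%N ->
  forall x u, admissible f X U N x u ->
  \sum_(T < N) S x u T.+1 <= N%:R * (K - lam x - lambar) ->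
  exists P, [/\ (P.+1 <= N./2)%N, dist_orbitX p Pi (traj f u x P.+1) <= d &
                S x u P.+1 <= 2 * K + 2 * lambar].
Proof.
move=> d0; have a0 : 0 < alpha d by case: alphaK => az _ ainc _; rewrite -az ainc.
(* More than [M] steps away from the orbit would exceed the budget [2 * K]. *)
pose M := Num.bound `|2 * K / alpha d|.
exists (M.+2).*2 => N MN x u xu sumS.
have HM : (M.+2 <= N./2)%N by clear -MN; lia.
have HN : (N./2 <= N)%N by clear; lia.
have N0 : (0 < N)%N by apply: leq_trans HN; exact: leq_trans HM.
pose r T := S x u T - lam (traj f u x T) + lam x.
have rnd i j : (i <= j <= N)%N -> r i <= r j.
  by move=> ijN; rewrite /r lerD2r; exact: (rotated_excess_cost_nondecr xu).
have r0 j : (j <= N)%N -> 0 <= r j.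
  move=> jN; rewrite -[leLHS](_ : r 0%N = 0); first exact: rnd.
  by rewrite /r /S excess_cost0 /=; lra.
have lamT T : (T <= N)%N -> - lambar <= lam (traj f u x T) <= lambar.
  by move=> TN; apply: lambar_bound; case: xu => _; apply.
have sumr : \sum_(T < N) r T.+1 <= N%:R * K.
  apply: (@le_trans _ _ (\sum_(T < N) (S x u T.+1 + (lam x + lambar)))).
    by apply: ler_sum => T _; have /andP[? ?] := lamT _ (ltn_ord T); rewrite /r; lra.
  rewrite big_split /= sum_ord_const.
  by rewrite -lerBrDr (le_trans sumS) // le_eqVlt; apply/orP; left; apply/eqP; ring.
(* By monotonicity each of the last [N - N./2] terms is at least [r N./2], and they are at least
   half of all terms. *)
have rH : r N./2 <= 2 * K.
  have : (N - N./2)%:R * r N./2 <= N%:R * K.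
    apply: le_trans sumr; have -> : \sum_(T < N) r T.+1 = \sum_(T < N./2) r T.+1 +
        \sum_(T < N - N./2) r (N./2 + T).+1.
      by rewrite -(big_ord_addn (fun T => r T.+1)) subnKC.
    rewrite -[leLHS]add0r lerD //.
      by apply: sumr_ge0 => T _; apply: r0; apply: leq_trans HN; exact: ltn_ord.
    rewrite -sum_ord_const.
    apply: ler_sum => T _; apply: rnd.
    by have := ltn_ord T; rewrite ltn_subRL => ->; rewrite andbT -addnS leq_addr.
  have K0 : 0 <= N%:R * K by apply: le_trans sumr; apply: sumr_ge0 => T _; exact: r0.
  have {}K0 : 0 <= K by move: K0; rewrite pmulr_rge0 // ltr0n.
  move=> h; have NH : N%:R <= 2 * (N - N./2)%:R :> R.
    by rewrite -natrM ler_nat; clear; lia.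
  have NH0 : 0 < (N - N./2)%:R :> R.
    by rewrite ltr0n; clear -N0; lia.
  rewrite -(ler_pM2l NH0) (le_trans h) // mulrCA mulrA.
  by rewrite (le_trans (ler_wpM2r K0 NH)).
have [[P [PH Pd]]|far] := pselect (exists P, (P.+2 <= N./2)%N /\
    dist_orbitX p Pi (traj f u x P.+1) <= d).
  exists P; split => //; first exact: ltnW.
  have PN : (P.+1 <= N)%N by apply: leq_trans HN; exact: ltnW.
  have rP : r P.+1 <= r N./2 by apply: rnd; rewrite HN andbT ltnW.
  have /andP[? ?] := lamT _ PN; have /= /andP[? ?] := lamT _ (leq0n N).
  by move: rP; rewrite {1}/r; lra.
have rinc j : (j.+1 <= N./2)%N -> j%:R * alpha d <= r j.+1.
  elim: j => [|j IHj jH]; first by rewrite mul0r => ?; apply: r0; exact: leq_trans HN.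
  have jN : (j.+1 < N)%N by apply: leq_trans HN.
  have := rotated_excess_cost_ge xu jN; rewrite -/(S _ _ _) -/(S x u j.+1).
  have dj : alpha d <= alpha (dist_orbit p Pi (traj f u x j.+1, u j.+1)).
    rewrite leNgt; apply/negP => /ltW /(Kinf_le_inv alphaK (ltW d0)) jd.
    apply: far; exists j; split => //.
    by apply: le_trans jd; exact: dist_orbitX_le.
  by have := IHj (ltnW jH); rewrite /r -natr1 mulrDl mul1r; lra.
exfalso; have := rinc N./2.-1; rewrite prednK; last exact: leq_trans HM.
move=> /(_ (leqnn _)); apply/negP; rewrite -ltNge (le_lt_trans rH) //.
rewrite -ltr_pdivrMr // (le_lt_trans (ler_norm _)) //.
apply: lt_le_trans (archi_boundP (normr_ge0 _)) _.
by rewrite ler_nat -/M; clear -HM; lia.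
Qed.

(* A loop at a point close to the orbit is inserted into the remainder of the
   given input, so that the last steps are dropped. *)
Lemma descent (K e : R) : 0 < e -> exists N1, forall N, (N1 <= N)%N ->
  forall x u, admissible f X U N x u ->
  \sum_(T < N) S x u T.+1 <= N%:R * (K - lam x - lambar) ->
  exists v, admissible f X U N (f x (u 0%N)) v /\
    \sum_(T < N) S (f x (u 0%N)) v T.+1 <=
      \sum_(T < N) S x u T.+1 - N%:R * (l x (u 0%N) - ls) + N%:R * e.
Proof.
move=> e0; have [L L0 loopL] := orbit_loop.
have [|d d0 loop] := loopL (e / 2); first by rewrite divr_gt0.
have [N1 turn] := turnpike K d0.
(* [D] collects the errors that do not grow with [N]: the cost accumulated before the loop, counted
   at [L] horizons, the costs within the loop, the dropped steps and the first step. *)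
pose D := L%:R * (2 * K + 2 * lambar) + L%:R * (L%:R + 2 * lambar)
  + L%:R * (2 * lambar) + 2 * lambar.
exists (N1 + (L.*2 + 2) + Num.bound `|2 * D / e|)%N => N NN1 x u xu sumS.
have [|Q [QN xd SQ]] := turn N _ x u xu sumS; first by clear -NN1; lia.
have DN : D <= N%:R * (e / 2).
  have : 2 * D / e <= N%:R.
    rewrite (le_trans (ler_norm _)) // (le_trans (ltW (archi_boundP (normr_ge0 _)))) //.
    by rewrite ler_nat; apply: leq_trans NN1; exact: leq_addl.
  by rewrite ler_pdivrMr //; lra.
(* The new input has [Q] shifted steps, [L] loop steps and [R'] resumed steps. The shift frees one
   step, so only [L.-1] steps of the old input are dropped. *)
have [R' NE] : exists R', N = (Q + (L + R'))%N.
  by exists (N - (Q + L))%N; clear -QN NN1; lia.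
have NE' : N = (Q.+1 + (R' + L.-1))%N by clear -NE L0; lia.
have QltN : (Q.+1 <= N)%N by clear -NE'; lia.
have xQX : X (traj f u x Q.+1) by case: xu => _; apply.
have [w [wadm wx Sw Swb]] := loop _ xQX xd.
have u1adm : admissible f X U Q (f x (u 0%N)) (shift_input 1 u).
  by apply: (@admissible_shift _ _ _ f X U 1); exact: admissible_le xu.
have x1Q : traj f (shift_input 1 u) (f x (u 0%N)) Q = traj f u x Q.+1.
  exact: (traj_shift f u x 1).
exists (concat_input Q (shift_input 1 u)
         (concat_input L w (shift_input Q.+1 u))); split.
  rewrite NE; apply: admissible_concat => //; rewrite x1Q.
  apply: admissible_concat => //; rewrite wx.
  by apply: admissible_shift; apply: admissible_le xu; clear -NE'; lia.
set v := concat_input Q _ _; set x1 := f x _.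
have S1 : S x u 1 = l x (u 0%N) - ls by rewrite /S excess_costS excess_cost0 add0r.
have SvQ T : (T <= Q)%N -> S x1 v T = S x u T.+1 - S x u 1.
  by move=> TQ; rewrite /S excess_cost_concat_l // -(excess_cost_shift f l ls 1).
have SvL T : (T <= L)%N ->
    S x1 v (Q + T)%N = S x u Q.+1 - S x u 1 + S (traj f u x Q.+1) w T.
  move=> TL; rewrite -SvQ // /S excess_cost_concat_r x1Q.
  by rewrite !excess_cost_concat_l.
have SvR T : S x1 v (Q + (L + T))%N =
    S (traj f u x Q.+1) w L + S x u (Q.+1 + T)%N - S x u 1.
  rewrite /S excess_cost_concat_r x1Q excess_cost_concat_r wx.
  rewrite (excess_cost_shift _ _ _ Q.+1) (excess_cost_shift f l ls 1 x u) add1n.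
  by ring.
have sumv : \sum_(T < N) S x1 v T.+1 =
    \sum_(T < Q) (S x u T.+2 - S x u 1)
    + (\sum_(T < L) (S x u Q.+1 - S x u 1 + S (traj f u x Q.+1) w T.+1)
    + \sum_(T < R') (S (traj f u x Q.+1) w L + S x u (Q.+1 + T).+1 - S x u 1)).
  rewrite NE (big_ord_addn (fun T => S x1 v T.+1)).
  rewrite (big_ord_addn (fun T => S x1 v (Q + T).+1)).
  congr (_ + (_ + _)); apply: eq_bigr => T _.
  - by rewrite SvQ.
  - by rewrite -addnS SvL.
  - by rewrite -!addnS SvR.
have sumu : \sum_(T < N) S x u T.+1 =
    S x u 1 + \sum_(T < Q) S x u T.+2
    + (\sum_(T < R') S x u (Q.+1 + T).+1
    + \sum_(T < L.-1) S x u (Q.+1 + (R' + T)).+1).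
  rewrite NE' (big_ord_addn (fun T => S x u T.+1)) big_ord_recl; congr (_ + _).
  exact: (big_ord_addn (fun T => S x u (Q.+1 + T).+1)).
have loopsum : \sum_(T < L) S (traj f u x Q.+1) w T.+1 <= L%:R * (L%:R + 2 * lambar).
  rewrite -sum_ord_const.
  by apply: ler_sum => T _; exact: Swb.
have dropped : - (L%:R * (2 * lambar)) <= \sum_(T < L.-1) S x u (Q.+1 + (R' + T)).+1.
  apply: (@le_trans _ _ (\sum_(T < L.-1) - (2 * lambar))).
    rewrite sum_ord_const mulrN lerN2.
    by rewrite ler_wpM2r ?mulr_ge0 // ler_nat leq_pred.
  by apply: ler_sum => T _; apply: (excess_cost_ge xu); case: T => T /= TL; clear -TL NE'; lia.
(* Every horizon after the loop carries its full cost; this is the error growing with [N], so the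
   loop cost must be at most [e / 2]. *)
have Rle : R'%:R * S (traj f u x Q.+1) w L <= N%:R * (e / 2).
  apply: (@le_trans _ _ (R'%:R * (e / 2))); first by rewrite ler_wpM2l.
  by rewrite ler_wpM2r ?(divr_ge0 (ltW e0)) ?ler_nat // NE addnA leq_addl.
have LSQ : L%:R * S x u Q.+1 <= L%:R * (2 * K + 2 * lambar) by rewrite ler_wpM2l.
have S1ge : - (2 * lambar) <= S x u 1 by apply: (excess_cost_ge xu); exact: leq_trans QltN.
have NR : N%:R = Q%:R + L%:R + R'%:R :> R by rewrite NE !natrD addrA.
rewrite sumv sumu -S1; rewrite /D in DN.
rewrite !sumrB !big_split /= !sum_ord_const.
move: (\sum_(T < Q) _) (\sum_(T < R') _) (\sum_(T < L.-1) _) (\sum_(T < L) _)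
  loopsum dropped => A1 A2 A3 A4 loopsum dropped.
have -> : N%:R * e = N%:R * (e / 2) + N%:R * (e / 2) by field.
by rewrite {1}NR; lra.
Qed.

(** * Invariance of sublevel sets and the closed-loop cost *)

Lemma JNbeta_ge N x u : (0 < N)%N -> admissible f X U N x u ->
  (N%:R + 1) / 2 * ls - 2 * lambar <= JNbeta f l N x u.
Proof.
move=> N0 xu; have N0' : 0 < N%:R :> R by rewrite ltr0n.
rewrite (JNbeta_excess_cost f l ls) // addrC lerD2r ler_pdivlMr // [_ * N%:R]mulrC.
rewrite -(sum_ord_const (- (2 * lambar))).
apply: ler_sum => T _.
exact: (excess_cost_ge xu).
Qed.

(** The inequality defining [Xpi], at one horizon and with the infimum replaced by the cost of a
    given input. *)
Definition sublevel (N : nat) (x : 'rV[R]_n) (u : nat -> 'rV[R]_m) (K : R) :=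
  JNbeta f l N x u - (N%:R + 1) / 2 * ls + (lam x + lambar) <= K.

Lemma sublevelP N x u K : (0 < N)%N ->
  sublevel N x u K <-> \sum_(T < N) S x u T.+1 <= N%:R * (K - lam x - lambar).
Proof.
move=> N0; have N0' : 0 < N%:R :> R by rewrite ltr0n.
rewrite /sublevel (JNbeta_excess_cost f l ls) // addrK.
by rewrite -lerBrDr ler_pdivrMr // mulrC opprD addrA.
Qed.

(* Either the rotated cost of the step pays for the error of [descent], or the
   successor is so close to the orbit that its value is bounded a priori. *)
Lemma sublevel_step (C : R) : exists2 K, C <= K & forall e, 0 < e ->
  exists N1, forall N, (N1 <= N)%N -> (0 < N)%N /\
  forall x u, admissible f X U N x u -> sublevel N x u K ->
  let x1 := f x (u 0%N) in
  (exists v, admissible f X U N x1 v /\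
     JNbeta f l N x1 v <= JNbeta f l N x u - (l x (u 0%N) - ls) + e) /\
  (exists v, admissible f X U N x1 v /\ sublevel N x1 v K).
Proof.
have [B [d d0 bounded]] := bounded_cost_near_orbit.
have [d' d'0 dmod] := orbit_modulus d0.
(* The second entry makes the inputs from [bounded_cost_near_orbit] satisfy the sublevel bound. *)
pose K := Num.max C (B + 2 * lambar).
have a0 : 0 < alpha d' by case: alphaK => az _ ainc _; rewrite -az ainc.
exists K; first by rewrite le_max lexx.
move=> e e0; have e20 : 0 < Num.min e (alpha d') by rewrite lt_min e0.
have [N1 desc] := descent K e20.
exists N1.+1 => N NN1; have N0 : (0 < N)%N by exact: leq_ltn_trans NN1.
have N0' : 0 < N%:R :> R by rewrite ltr0n.
split=> // x u xu /sublevelP => /(_ N0) sumS x1.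
have [v [vadm sumv]] := desc _ (ltnW NN1) _ _ xu sumS.
have [uU xX] := xu; have Xx := xX _ (leq0n N); have Xx1 : X x1 by exact: (xX 1%N N0).
have Jv : JNbeta f l N x1 v <=
    JNbeta f l N x u - (l x (u 0%N) - ls) + Num.min e (alpha d').
  rewrite !(JNbeta_excess_cost f l ls) //.
  have : (\sum_(T < N) S x1 v T.+1) / N%:R <= (\sum_(T < N) S x u T.+1) / N%:R
      - (l x (u 0%N) - ls) + Num.min e (alpha d').
    rewrite ler_pdivrMr // !mulrDl divfK ?gt_eqF // mulNr.
    by rewrite ![_ * N%:R]mulrC.
  by lra.
split; first by exists v; split => //; rewrite (le_trans Jv) // lerD2l ge_min lexx.
(* If the rotated step cost covers the error, [v] stays in the sublevel. Otherwise [alpha] puts the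
   current pair within [d'] of the orbit, and continuity puts [x1] within [d]. *)
have [big|small] := leP (Num.min e (alpha d')) (l x (u 0%N) - ls + lam x - lam x1).
  by exists v; split => //; move: sumS => /(sublevelP _ _ _ N0); rewrite /sublevel; lra.
have [k kp dk] := dist_orbit_attained (x, u 0%N).
have [_ fk] : `|l x (u 0%N) - l (Pi k).1 (Pi k).2| <= d /\
    `|f x (u 0%N) - (Pi (k.+1 %% p)).1| <= d.
  apply: dmod => //; first exact: uU.
  rewrite -dk; apply: (Kinf_le_inv alphaK (ltW d'0)).
  apply: (le_trans (dissip Xx (uU _ N0) Xx1)); apply: (le_trans (ltW small)).
  by rewrite ge_min lexx orbT.
have [w [wadm wB]] := bounded _ Xx1 (le_trans (dist_orbitX_leP _ (modp _)) fk) N.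
exists w; split => //; apply/sublevelP => //; rewrite -sum_ord_const.
apply: ler_sum => T _; apply: (le_trans (wB _ (ltn_ord T))).
have : B + 2 * lambar <= K by rewrite le_max lexx orbT.
by have /andP[? ?] := lambar_bound Xx1; lra.
Qed.

(** The value inequality telescopes along the closed loop, and the invariant level [K] allows it to
    be repeated. [D] is the initial cost minus the lower bound of [JNbeta_ge]. *)
Lemma closed_loop_cost (C e : R) : 0 < e -> exists N1, forall N, (N1 <= N)%N ->
  forall mu, is_MPC_feedback f l X U N mu ->
  forall x u, admissible f X U N x u -> sublevel N x u C ->
  exists D, forall T, JT f l mu x T <= D + T%:R * (ls + e).
Proof.
move=> e0; have [K CK step] := sublevel_step C; have [N1 stepN] := step e e0.
exists N1 => N NN1 mu muP x u xu uC; have [N0 {}stepN] := stepN N NN1.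
(* Any admissible input may be replaced by the minimizer whose first value [mu] applies. *)
have opt y v K' : admissible f X U N y v -> sublevel N y v K' ->
    exists v', [/\ admissible f X U N y v', mu y = v' 0%N, sublevel N y v' K' &
    forall w, admissible f X U N y w -> JNbeta f l N y v' <= JNbeta f l N y w].
  move=> yv vK; have Xy : X y by case: (yv) => _ /(_ 0%N); exact.
  have [v' [yv' v'min muv']] := muP y Xy (ex_intro _ v yv).
  exists v'; split => //; apply: le_trans vK.
  by rewrite lerD2r lerD2r v'min.
pose y := cltraj f mu x.
have inv T : exists v, [/\ admissible f X U N (y T) v, mu (y T) = v 0%N,
    sublevel N (y T) v K &
    JT f l mu x T <= JNbeta f l N x u - JNbeta f l N (y T) v + T%:R * (ls + e)].
  elim: T => [|T [v [vadm muv vK JTle]]].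
    have [v [vadm muv vC vmin]] := opt _ _ _ xu uC.
    exists v; split => //; first exact: le_trans CK.
    by rewrite /JT big_ord0 mul0r addr0 subr_ge0 vmin.
  have [[w [wadm Jw]] [w' [w'adm w'K]]] := stepN _ _ vadm vK.
  have [v' [v'adm muv' v'K v'min]] := opt _ _ _ w'adm w'K.
  have yS : y T.+1 = f (y T) (v 0%N) by rewrite -muv.
  exists v'; rewrite yS; split => //.
  rewrite /JT big_ord_recr /= -/(JT f l mu x T) -/(y T) muv.
  by rewrite -natr1 mulrDl mul1r; have := v'min _ wadm; lra.
exists (JNbeta f l N x u - ((N%:R + 1) / 2 * ls - 2 * lambar)) => T.
have [v [vadm _ _ /le_trans]] := inv T; apply.
by rewrite lerD2r lerD2l lerN2 JNbeta_ge.
Qed.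

End DissipativeOrbit.

(** * From eventual bounds to a rate *)

Lemma limn_esup_average {R : realType} (a : nat -> R) (D c : R) :
  (forall T, a T <= D + T%:R * c) ->
  (limn_esup (fun T => (a T / T%:R)%:E) <= c%:E)%E.
Proof.
move=> aD; rewrite limn_esup_lim (cvg_lim _ (@cvg_esups_inf _ _)) //.
apply/lee_addgt0Pr => e e0.
(* Beyond [M] the term [D / T] is at most [e]; the successor keeps [T] positive. *)
pose M := (Num.bound `|D / e|).+1.
apply: ge_ereal_inf; exists (esups (fun T => (a T / T%:R)%:E) M); first by exists M.
apply: ge_ereal_sup => _ [T /= MT <-]; rewrite lee_fin.
have T0 : 0 < T%:R :> R by rewrite ltr0n; exact: leq_trans MT.
have : D / e <= T%:R.
  rewrite (le_trans (ler_norm _)) //.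
  by rewrite (le_trans (ltW (archi_boundP (normr_ge0 _)))) // ler_nat ltnW.
by rewrite ler_pdivrMr // ler_pdivrMr // => DT; rewrite (le_trans (aD T)) //; lra.
Qed.

Lemma invD1_lipschitz {R : realType} (a b : R) : 0 <= a -> a <= b ->
  (1 + a)^-1 - (1 + b)^-1 <= b - a.
Proof.
move=> a0 ab; have a1 : 0 < 1 + a by lra.
have b1 : 0 < 1 + b by lra.
have -> : (1 + a)^-1 - (1 + b)^-1 = (b - a) / ((1 + a) * (1 + b)).
  by field; rewrite !gt_eqF.
by rewrite ler_pdivrMr ?mulr_gt0 // ler_peMr ?subr_ge0 // mulr_ege1 //; lra.
Qed.

Lemma lipschitz_within_continuous {R : realType} (g : R -> R) (k : R) : 0 < k ->
  (forall x y, 0 <= x -> x <= y -> `|g x - g y| <= k * (y - x)) ->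
  {within [set x : R | 0 <= x], continuous g}.
Proof.
move=> k0 gk; apply/subspace_continuousP => x /= x0.
apply/cvgrPdist_le => e e0; apply/nbhs_ballP; exists (e / k) => /=.
  exact: divr_gt0.
move=> y; rewrite /ball /= => xy y0; rewrite /from_subspace.
have [xley|/ltW ylex] := leP x y.
  rewrite (le_trans (gk _ _ x0 xley)) // -ler_pdivlMl // mulrC.
  by rewrite distrC ger0_norm ?subr_ge0 // in xy; exact: ltW.
rewrite distrC (le_trans (gk _ _ y0 ylex)) // -ler_pdivlMl // mulrC.
by rewrite ger0_norm ?subr_ge0 // in xy; exact: ltW.
Qed.

(* The supremum of the failing bounds e at N, each damped by the 1-Lipschitz
   factor 1 / (1 + max 0 (x - N)), is Lipschitz, nonincreasing and vanishes at
   infinity; adding 1 / (1 + x) makes it strictly decreasing. *)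
Lemma Lclass_rate {R : realType} (P : nat -> R -> Prop) :
  (forall N e e', P N e -> e <= e' -> P N e') ->
  (forall e, 0 < e -> exists N1, forall N, (N1 <= N)%N -> P N e) ->
  exists (delta : R -> R) (N0 : nat), Lclass delta /\
    forall N, (N0 <= N)%N -> P N (delta N%:R).
Proof.
move=> Pmono Pev; have [N0 PN0] := Pev 1 ltr01.
pose phi (t : R) := (1 + Num.max 0 t)^-1.
have max1 (t : R) : 0 < 1 + Num.max 0 t by rewrite ltr_pwDl // le_max lexx.
have phi_gt0 t : 0 < phi t by rewrite invr_gt0.
have phi_le1 t : phi t <= 1 by rewrite invf_le1 // lerDl le_max lexx.
have phi_ninc s t : s <= t -> phi t <= phi s.
  by move=> st; rewrite lef_pV2 ?posrE // lerD2l ge_max !le_max lexx st orbT.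
have phi_lip s t : s <= t -> phi s <= phi t + (t - s).
  move=> st; rewrite -lerBlDl (le_trans (@invD1_lipschitz _ _ _ _ _)) //.
  - by rewrite le_max lexx.
  - by rewrite ge_max !le_max lexx st orbT.
  - by rewrite !maxEle; case: ifP => s0; case: ifP => t0; lra.
pose E x : set R := [set y | y = 0 \/ exists N e,
  [/\ (N0 <= N)%N, ~ P N e, 0 <= e & y = e * phi (x - N%:R)]].
have E0 x : E x 0 by left.
have Pe1 N e : (N0 <= N)%N -> ~ P N e -> e <= 1.
  move=> /PN0 PN1 nPe; rewrite leNgt; apply/negP => /ltW /(Pmono _ _ _ PN1).
  exact: nPe.
have E1 x y : E x y -> y <= 1.
  move=> [->//|[N [e [NN0 nP e0 ->]]]].
  by rewrite mulr_ile1 // ?(ltW (phi_gt0 _)) //; exact: Pe1 _ _ NN0 nP.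
have supub x : ubound (E x) (sup (E x)).
  by apply: ub_le_sup; exists 1 => y; exact: E1.
have suple x M : (forall y, E x y -> y <= M) -> sup (E x) <= M.
  by move=> EM; apply: ge_sup; [exists 0 | move=> y; exact: EM].
have sup0 x : 0 <= sup (E x) by apply: supub; exact: E0.
have supninc x y : x <= y -> sup (E y) <= sup (E x).
  move=> xy; apply: suple => _ [->//|[N [e [NN0 nP e0 ->]]]].
  apply: (@le_trans _ _ (e * phi (x - N%:R))).
    by rewrite ler_wpM2l // phi_ninc // lerD2r.
  by apply: supub; right; exists N, e.
have suplip x y : x <= y -> sup (E x) <= sup (E y) + (y - x).
  move=> xy; apply: suple => _ [->|[N [e [NN0 nP e0 ->]]]].
    by rewrite addr_ge0 // subr_ge0.
  have h : e * phi (y - N%:R) <= sup (E y) by apply: supub; right; exists N, e.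
  have : phi (x - N%:R) <= phi (y - N%:R) + (y - x).
    have -> : y - x = y - N%:R - (x - N%:R) by ring.
    by apply: phi_lip; rewrite lerD2r.
  move=> /(ler_wpM2l e0) /le_trans; apply.
  rewrite mulrDr lerD // ler_piMl ?subr_ge0 //; exact: Pe1 _ _ NN0 nP.
pose delta x := sup (E x) + (1 + x)^-1.
have inv_gt0 (x : R) : 0 <= x -> 0 < (1 + x)^-1.
  by move=> x0; rewrite invr_gt0 ltr_pwDl.
exists delta, N0; split; last first.
  (* If [delta N] failed at [N], it would belong to [E N] undamped, contradicting the positive term
     added to the supremum. *)
  move=> N NN0; apply: contrapT => nP.
  have d0 : 0 < delta N%:R by rewrite ltr_pwDr // inv_gt0.
  have : delta N%:R <= sup (E N%:R).
    apply: supub; right; exists N, (delta N%:R); split => //; first exact: ltW.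
    by rewrite subrr /phi maxxx addr0 invr1 mulr1.
  by rewrite /delta gerDl leNgt inv_gt0.
split.
- apply: (@lipschitz_within_continuous _ _ 2) => // x y x0 xy.
  have y0 := le_trans x0 xy; have xylip := invD1_lipschitz x0 xy.
  have xyinv : (1 + y)^-1 <= (1 + x)^-1.
    by rewrite lef_pV2 ?posrE ?ltr_pwDl // lerD2l.
  have := suplip _ _ xy; have := supninc _ _ xy => ? ?.
  by rewrite ger0_norm /delta; lra.
- by move=> x x0; rewrite addr_ge0 // ltW // inv_gt0.
- move=> x y x0 xy; rewrite ler_ltD ?supninc ?(ltW xy) //.
  have y0 : 0 <= y by exact: le_trans (ltW xy).
  by rewrite ltf_pV2 ?posrE ?ltrD2l // ltr_pwDl.
- apply/cvgrPdist_le => e e0; have e20 : 0 < e / 2 by rewrite divr_gt0.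
  have [K PK] := Pev _ e20.
  have eV0 : 0 < (e / 2)^-1 by rewrite invr_gt0.
  (* From horizon [K] on, failing bounds are at most [e / 2]; those of earlier horizons are damped
     below [e / 2] at this distance. *)
  exists (K%:R + (e / 2)^-1); split; first exact: num_real.
  move=> x Kx; have K0 : 0 <= K%:R :> R by [].
  have x0 : 0 <= x by lra.
  rewrite sub0r normrN ger0_norm; last by rewrite addr_ge0 // ltW // inv_gt0.
  have small (t : R) : (e / 2)^-1 <= t -> (1 + t)^-1 <= e / 2.
    move=> et; rewrite -[leRHS]invrK lef_pV2 ?posrE //; lra.
  rewrite /delta [leRHS](splitr e) lerD ?small //; last by lra.
  apply: suple => _ [->|[N [e' [NN0 nP e'0 ->]]]]; first exact: ltW.
  have [KN|NK] := leqP K N.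
    apply: (@le_trans _ _ e'); first by rewrite ler_piMr.
    rewrite leNgt; apply/negP => /ltW /(Pmono _ _ _ (PK _ KN)); exact: nP.
  have NK' : N%:R <= K%:R :> R by rewrite ler_nat ltnW.
  apply: (@le_trans _ _ (phi (x - N%:R))).
    by rewrite ler_piMl ?(ltW (phi_gt0 _)) //; exact: Pe1 _ _ NN0 nP.
  by apply: small; rewrite le_max; apply/orP; right; lra.
Qed.

(** * Optimal inputs and the performance bound *)

(** A finite bound excludes the value [+oo] of an infeasible problem, so the feedback property
    supplies a minimizer attaining the infimum. *)
Lemma VNbeta_finite_optimum {R : realType} {n m : nat}
  (f : 'rV[R]_n -> 'rV[R]_m -> 'rV[R]_n) (l : 'rV[R]_n -> 'rV[R]_m -> R)
  (X : set 'rV[R]_n) (U : set 'rV[R]_m) (N : nat) (mu : 'rV[R]_n -> 'rV[R]_m)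
  (x : 'rV[R]_n) (a b C : R) : is_MPC_feedback f l X U N mu -> X x ->
  (VNbeta f l X U N x - a%:E + b%:E <= C%:E)%E ->
  exists u, admissible f X U N x u /\ JNbeta f l N x u - a + b <= C.
Proof.
move=> muP Xx VC.
have : (VNbeta f l X U N x < +oo)%E.
  by rewrite ltey; apply/eqP => V; move: VC; rewrite V.
move=> /ereal_inf_ltP[_ [v xv _] _].
have [u [xu umin _]] := muP x Xx (ex_intro _ v xv).
exists u; split => //; rewrite -lee_fin EFinD EFinB (le_trans _ VC) //.
rewrite leeD2r // leeD2r //; apply: le_ereal_inf_tmp => _ [w xw <-].
by rewrite lee_fin umin.
Qed.
Unset Implicit Arguments.

Theorem theorem10 (R : realType) (n m : nat)
  (f : 'rV[R]_n -> 'rV[R]_m -> 'rV[R]_n) (l : 'rV[R]_n -> 'rV[R]_m -> R)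
  (X : set 'rV[R]_n) (U : set 'rV[R]_m)
  (pstar : nat) (Pistar : nat -> 'rV[R]_n * 'rV[R]_m)
  (lam : 'rV[R]_n -> R) (lambar : R) (alpha : R -> R)
  (kappa : R) (M' : nat) (rho : R -> R) (C : R) :
  (* (A1) *)
  compact X -> compact U ->
  {within X `*` U, continuous (fun z => f z.1 z.2)} ->
  {within X `*` U, continuous (fun z => l z.1 z.2)} ->
  (* Pi^star: a feasible pstar-periodic orbit attaining l^star *)
  periodic_orbit f X U pstar Pistar ->
  avg_cost l pstar Pistar = lstar f l X U ->
  (* (A3) *)
  (forall x, X x -> `|lam x| <= lambar) ->
  Kinf alpha ->
  (forall x u, X x -> U u -> X (f x u) ->
     alpha (dist_orbit pstar Pistar (x, u))
       <= l x u - lstar f l X U + lam x - lam (f x u)) ->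
  (* (A4) *)
  0 < kappa -> Kinf rho ->
  (forall k x y, (k < pstar)%N -> X x -> X y ->
     `|x - (Pistar k).1| <= kappa -> `|y - (Pistar k).1| <= kappa ->
     exists u, [/\ admissible f X U M' x u, traj f u x M' = y &
       forall j, (j < M')%N ->
         dist_orbit pstar Pistar (traj f u x j, u j)
           <= rho (Num.max (dist_orbitX pstar Pistar x)
                           (dist_orbitX pstar Pistar y))]) ->
  (* C > C(M') *)
  M'%:R * (lmax l X U - lstar f l X U) + 2 * lambar
    + lstar f l X U * pstar%:R < C ->
  exists (delta : R -> R) (N0 : nat), Lclass delta /\
    forall N, (N0 <= N)%N ->
    forall mu, is_MPC_feedback f l X U N mu ->
    forall x, Xpi f l X U lam lambar C N0 x ->
      (Jav f l mu x <= (lstar f l X U + delta N%:R)%:E)%E.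
Proof.
move=> _ _ fcont lcont orbitPi avgPi lamP alphaK dissip kappa0 rhoK ctrl _.
set ls := lstar f l X U in avgPi dissip *.
(* The property is uniform in the feedback and the initial state, so one rate serves all of them. *)
have [||delta [N0 [deltaL rate]]] := @Lclass_rate R (fun N e =>
    forall mu, is_MPC_feedback f l X U N mu -> forall x u,
    admissible f X U N x u -> sublevel f l lam lambar ls N x u C ->
    (Jav f l mu x <= (ls + e)%:E)%E).
- move=> N e e' Pe ee' mu muP x u xu uC.
  by rewrite (le_trans (Pe mu muP x u xu uC)) // lee_fin lerD2l.
- move=> e e0; have [N1 cost] := closed_loop_cost fcont lcont orbitPi avgPi lamP
    alphaK dissip kappa0 rhoK ctrl C e0.
  exists N1 => N NN1 mu muP x u xu uC.
  have [D JTD] := cost N NN1 mu muP x u xu uC.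
  exact: limn_esup_average JTD.
exists delta, N0; split => // N NN0 mu muP x [Xx VC].
have [u [xu uC]] := VNbeta_finite_optimum muP Xx (VC N NN0).
exact: rate NN0 mu muP x u xu uC.
Qed.
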